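(* Let $(G,X)$ be a minimal flow on a compact Hausdorff space $X$ with phase group $G$, and let $T$ be a subsemigroup of $G$ generating $G$, i.e. $G=\langle T\rangle$. If $(T,X)$ is distal and if there exists $x_0\in X$ such that the weakly almost periodic functions on $X$ with respect to $(T,X)$ separate $x_0$, then $(G,X)$ is an equicontinuous flow.
   Context: $X$ is a nonempty compact Hausdorff space with compatible uniformity $\mathscr U_X$. A flow $(G,X)$ is a jointly continuous action $G\times X\to X$ of a topological group $G$; $T$ (a subsemigroup with identity $e$) acts by restriction, giving the semiflow $(T,X)$. $(G,X)$ is minimal if $Gx$ is dense in $X$ for every $x$. $(T,X)$ is distal if for all $x\ne y$ there is $\alpha\in\mathscr U_X$ with $(tx,ty)\notin\alpha$ for all $t\in T$. $(G,X)$ is equicontinuous if for every $\varepsilon\in\mathscr U_X$ there is $\delta\in\mathscr U_X$ such that $(x,y)\in\delta$ implies $(gx,gy)\in\varepsilon$ for all $g\in G$. $C(X)$ is the algebra of real-valued continuous functions on $X$; for $f\in C(X)$ and $t\in T$, $(ft)(x)=f(tx)$ and $fT=\{ft:t\in T\}$. $f\in C(X)$ is a weakly almost periodic function with respect to $(T,X)$ if $fT$ is relatively compact in $C(X)$ with the topology of pointwise convergence. A set $F\subseteq C(X)$ separates $x_0$ if for every $x\in X$ with $x\ne x_0$ there is $f\in F$ with $f(x)\neq f(x_0)$. *)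

(* Defs.v *)
From HB Require Import structures.
From mathcomp Require Import all_boot all_order all_algebra.
From mathcomp Require Import all_classical all_reals all_analysis.

Set Implicit Arguments.
Unset Strict Implicit.
Unset Printing Implicit Defensive.

Import numFieldNormedType.Exports.

Local Open Scope classical_set_scope.
Local Open Scope group_scope.

HB.mixin Record isTopologicalGroup G & Topological G & Group G := {
  mulg_continuous : continuous (fun p : G * G => p.1 * p.2) ;
  invg_continuous : continuous (fun g : G => g^-1)
}.

#[short(type="topologicalGroupType")]
HB.structure Definition TopologicalGroup :=
  {G of Topological G & Group G & isTopologicalGroup G}.

Definition subsemigroup_with_id (G : groupType) (T : set G) :=
  monoid_closed [in T].

Definition generated_subgroup (G : groupType) (T : set G) : set G :=
  smallest [set H : set G | group_closed [in H]] T.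

Record flow (G : topologicalGroupType) (X : topologicalType) := Flow {
  act : G -> X -> X ;
  act1 : forall x, act 1 x = x ;
  actM : forall g h x, act (g * h) x = act g (act h x) ;
  act_continuous : continuous (fun p : G * X => act p.1 p.2)
}.

Lemma act_continuousr (G : topologicalGroupType) (X : topologicalType)
  (phi : flow G X) (g : G) : continuous (act phi g).
Proof.
move=> x.
apply: (@continuous_comp _ _ _ (fun y => (g, y)) (fun p => act phi p.1 p.2)).
  by apply: cvg_pair; [exact: cvg_cst|exact: cvg_id].
exact: act_continuous.
Qed.

HB.instance Definition _ (G : topologicalGroupType) (X : topologicalType)
    (phi : flow G X) (g : G) :=
  @isContinuous.Build X X (act phi g) (@act_continuousr G X phi g).

Definition minimal_flow (G : topologicalGroupType) (X : topologicalType)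
    (phi : flow G X) :=
  forall x : X, dense [set act phi g x | g in [set: G]].

Definition distal_semiflow (G : topologicalGroupType) (X : uniformType)
    (phi : flow G X) (T : set G) :=
  forall x y : X, x <> y ->
    exists2 a : set (X * X), entourage a &
      forall t, T t -> ~ a (act phi t x, act phi t y).

(* This is uniform equicontinuity, whereas the library's [equicontinuous] is
   equicontinuity at every point. *)
Definition equicontinuous_flow (G : topologicalGroupType) (X : uniformType)
    (phi : flow G X) :=
  forall e : set (X * X), entourage e ->
    exists2 d : set (X * X), entourage d &
      forall x y, d (x, y) -> forall g, e (act phi g x, act phi g y).

Section weakly_almost_periodic.
Context (R : realType) (G : topologicalGroupType) (X : topologicalType).
Context (phi : flow G X) (T : set G).

Definition right_orbit (f : continuousType X R) : set (continuousType X R) :=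
  [set (f \o act phi t : continuousType X R) | t in T].

(* [ArrowAsProduct] puts on [continuousType X R] the subspace topology of
   [{ptws X -> R}]; closure and compactness are thus taken inside C(X), not in
   the space of all functions. *)
Import ArrowAsProduct.

Definition weakly_almost_periodic (f : continuousType X R) :=
  precompact (right_orbit f).

End weakly_almost_periodic.

Definition separates_point (R : realType) (X : topologicalType)
    (F : set (continuousType X R)) (x0 : X) :=
  forall x : X, x <> x0 -> exists2 f, F f & f x <> f x0.

(* Main.v *)
Require Import Defs.
From mathcomp Require Import all_boot all_order all_algebra.
From mathcomp Require Import all_classical all_reals all_analysis.
From mathcomp Require Import lra.

(* Let E be the closure of T in X^X. By distality the identity is the only
   idempotent of E, so E is a group (Ellis) and contains the action of G. If f
   is weakly almost periodic then f \o p is continuous for p in E; translating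
   by E, which is transitive on X by minimality, such f separate all points, so
   every p in E is continuous.
   If some continuous f had a family f \o g (g in G) not controlled up to e by
   finitely many of its members, a countable subgroup H of G would witness it.
   The closure K of H is again a group of homeomorphisms, and Baire's theorem
   gives a nonempty open subset of K on which finitely many members do control
   f \o p up to e; finitely many right translates of it cover K, a
   contradiction. Such finite control for a separating family of functions
   yields equicontinuity. *)

Set Implicit Arguments.
Unset Strict Implicit.
Unset Printing Implicit Defensive.

Import numFieldNormedType.Exports.
Import Order.TTheory GRing.Theory Num.Theory.

Local Open Scope classical_set_scope.

(** * Closed semigroups of selfmaps under pointwise convergence *)

Lemma closure_preimage_closed (T U : topologicalType) (f : T -> U) (A : set T)
    (D : set U) : continuous f -> closed D ->
  (forall t, A t -> D (f t)) -> forall t, closure A t -> D (f t).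
Proof.
move=> fc cD AD t At; apply: cD => V /fc /At[s [/AD Dfs Vfs]].
by exists (f s).
Qed.

Section pointwise_topology.
Import ArrowAsProduct.

Lemma continuous_arrow (I : Type) (T : topologicalType) (Z : topologicalType)
    (h : T -> (I -> Z)) :
  (forall i, continuous (h ^~ i)) -> continuous h.
Proof.
move=> hc t; apply/cvg_sup => i.
exact: (@continuous_comp_initial _ _ _ (fun f : I -> Z => f i) h (hc i) t).
Qed.

Lemma continuous_eval (X Z : topologicalType) (x : X) :
  continuous (fun p : X -> Z => p x).
Proof. exact: (@proj_continuous X (fun=> Z) x). Qed.

Context {X : topologicalType}.
Implicit Types (p q : X -> X) (S : set (X -> X)).

Lemma continuous_precomp q : continuous (fun p => p \o q).
Proof. by apply: continuous_arrow => x; exact: continuous_eval. Qed.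

Lemma continuous_postcomp (Z : topologicalType) (f : X -> Z) :
  continuous f -> continuous (fun p => f \o p).
Proof.
move=> fc; apply: continuous_arrow => x p.
by move=> V /fc; exact: continuous_eval.
Qed.

Definition comp_closed S := forall p q, S p -> S q -> S (p \o q).

(** Precomposition is always continuous, postcomposition only by a continuous map. So the limit in
    the outer factor is removed first: that factor then lies in [S], is continuous, and the limit in
    the inner factor can follow. *)
Lemma comp_closed_closure S : (forall p, S p -> continuous p) ->
  comp_closed S -> comp_closed (closure S).
Proof.
move=> Sc SS p q Sp Sq.
have cl : closed (closure S) by exact: closed_closure.
apply: (closure_preimage_closed (continuous_precomp (q := q)) cl) Sp => r Sr.
apply: (closure_preimage_closed (continuous_postcomp (Sc _ Sr)) cl) Sq => s Ss.
by apply: subset_closure; exact: SS.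
Qed.

Hypothesis X_compact : compact [set: X].
Hypothesis X_hausdorff : hausdorff_space X.

Lemma compact_selfmaps : compact [set: X -> X].
Proof.
have := @tychonoff X (fun=> X) (fun=> setT) (fun=> X_compact).
by congr compact; apply/seteqP; split.
Qed.

Lemma hausdorff_selfmaps : hausdorff_space (X -> X).
Proof. exact: (@hausdorff_product X (fun=> X)). Qed.

Lemma closed_selfmaps_compact S : closed S -> compact S.
Proof. by move=> cS; apply: subclosed_compact cS compact_selfmaps _. Qed.

(* Zorn's lemma applied to the complements. *)
Lemma minimal_closed_subsemigroup S : closed S -> S !=set0 -> comp_closed S ->
  exists M, [/\ closed M, M !=set0, comp_closed M, M `<=` S &
    forall N, closed N -> N !=set0 -> comp_closed N -> N `<=` M -> N = M].
Proof.
move=> cS S0 SS.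
pose P (A : set (X -> X)) :=
  [/\ closed (S `\` A), S `\` A !=set0 & comp_closed (S `\` A)].
have [F FP Ftot|A [[cM M0 MM] Amax]] := @Zorn_bigcup (X -> X) P.
  have [->|[A0 FA0]] : F = set0 \/ F !=set0.
  - by have [->|/set0P] := eqVneq F set0; [left|right].
  - by rewrite bigcup_set0 /P setD0.
  have SDE p : (S `\` \bigcup_(A in F) A) p <-> forall A, F A -> (S `\` A) p.
    split=> [[Sp nFp] A FA|Fp].
      by split=> // Ap; apply: nFp; exists A.
    split; first by have [] := Fp _ FA0.
    by move=> [A FA Ap]; have [_] := Fp _ FA.
  split.
  - move=> p clp; apply/SDE => A FA; have [cA _ _] := FP _ FA; apply: cA.
    by apply: closureS clp => q /SDE; exact.
  (* The sets [S \ A] of the chain form a filter base of nonempty closed sets; a cluster point,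
     given by compactness, lies in all of them. *)
  - pose G := filter_from F (fun A => S `\` A).
    have GF : ProperFilter G.
      apply: filter_from_proper; last by move=> A /FP[].
      apply: filter_from_filter; first by exists A0.
      move=> A B FA FB; have [AB|BA] := Ftot _ _ FA FB.
        by exists B => // p [Sp nBp]; split; split=> // /AB.
      by exists A => // p [Sp nAp]; split; split=> // /BA.
    have [p [_ clGp]] := compact_selfmaps GF (filterT).
    exists p; apply/SDE => A FA; have [cA _ _] := FP _ FA; apply: cA.
    by move=> V Vp; apply: clGp => //; exists A.
  - move=> p q /SDE Fp /SDE Fq; apply/SDE => A FA.
    by have [_ _ AA] := FP _ FA; apply: AA; [exact: Fp|exact: Fq].
exists (S `\` A); split=> // N cN N0 NN NM.
apply/seteqP; split=> // p [Sp nAp]; apply: contrapT => nNp.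
have SN : S `\` ~` N = N.
  by apply/seteqP; split=> [q [_]/contrapT//|q Nq]; split=> //; case: (NM q Nq).
apply: (Amax (~` N)); last by rewrite /P SN.
split=> [q Aq /NM[]//|NA].
by apply: nAp; exact: NA.
Qed.

(** Ellis-Numakura: for [u] in a minimal [M], minimality gives [M u = M], so the members [p] of [M]
    with [p u = u] form a nonempty closed subsemigroup, which is again [M] and contains [u]. Only
    right translations need to be continuous. *)
Lemma idempotent_selfmap S : closed S -> S !=set0 -> comp_closed S ->
  exists2 u, S u & u \o u = u.
Proof.
move=> cS S0 SS.
have [M [cM [u Mu] MM MS Mmin]] := minimal_closed_subsemigroup cS S0 SS.
have Muclosed : closed [set p \o u | p in M].
  apply: compact_closed; first exact: hausdorff_selfmaps.
  apply: continuous_compact; last exact: closed_selfmaps_compact.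
  by apply: continuous_subspaceT => p; exact: continuous_precomp.
have MuE : [set p \o u | p in M] = M.
  apply: Mmin => //; first by exists (u \o u), u.
    by move=> _ _ [p Mp <-] [q Mq <-]; exists (p \o u \o q);
      [exact: (MM _ _ (MM _ _ Mp Mu) Mq)|].
  by move=> _ [p Mp <-]; exact: MM.
have NE : M `&` [set p : X -> X | p \o u = u] = M.
  apply: Mmin.
  - apply: closedI => //; apply: (preimage_closed (D := [set u])).
      by move=> p _; exact: continuous_precomp.
    exact/accessible_closed_set1/hausdorff_accessible/hausdorff_selfmaps.
  - have [p Mp pu] : [set p \o u | p in M] u by rewrite MuE.
    by exists p.
  - move=> p q [Mp pu] [Mq qu]; split; first exact: MM.
    by rewrite /= -compA qu.
  - by move=> p [].
exists u; first exact: MS.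
by have := Mu; rewrite -NE => -[].
Qed.

(** The left ideal [S p] is itself a closed subsemigroup, so it contains an idempotent [q p], which
    must be [id]. *)
Lemma closed_subsemigroup_left_inverse S : closed S -> comp_closed S ->
    (forall u, S u -> u \o u = u -> u = id) ->
  forall p, S p -> exists2 q, S q & q \o p = id.
Proof.
move=> cS SS Sid p Sp.
have [|||u [q Sq <-] uu] := @idempotent_selfmap [set q \o p | q in S].
- apply: compact_closed; first exact: hausdorff_selfmaps.
  apply: continuous_compact; last exact: closed_selfmaps_compact.
  by apply: continuous_subspaceT => q; exact: continuous_precomp.
- by exists (p \o p), p.
- by move=> _ _ [q Sq <-] [r Sr <-]; exists (q \o p \o r);
    [exact: (SS _ _ (SS _ _ Sq Sp) Sr)|].
by exists q => //; apply: Sid => //; exact: SS.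
Qed.

Lemma closed_subsemigroup_inverse S : closed S -> comp_closed S ->
    (forall u, S u -> u \o u = u -> u = id) ->
  forall p, S p -> exists q, [/\ S q, q \o p = id & p \o q = id].
Proof.
move=> cS SS Sid p Sp.
have [q Sq qp] := closed_subsemigroup_left_inverse cS SS Sid Sp.
have [r Sr rq] := closed_subsemigroup_left_inverse cS SS Sid Sq.
suff rp : r = p by exists q; split=> //; rewrite -rp.
have -> : r = r \o (q \o p) by rewrite qp.
by rewrite compA rq.
Qed.

End pointwise_topology.

(** * Baire category, and continuity tested by separating functions *)

(** Otherwise regularity yields open sets [U n] meeting [K], with the closure of [U n.+1] inside
    [U n] and off [A n]. Points chosen in [K] and [U n] cluster at a point of [K] outside every
    [A n]. *)
Lemma compact_baire (T : topologicalType) (K : set T) (A : (set T)^nat) :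
    regular_space T -> compact K -> K !=set0 -> (forall n, closed (A n)) ->
    K `<=` \bigcup_n A n ->
  exists n U, [/\ open U, K `&` U !=set0 & K `&` U `<=` A n].
Proof.
move=> Treg cK K0 cA KA; apply: contrapT => noU.
pose good (U : set T) := open U /\ K `&` U !=set0.
(* The hypothesis [good] stands under the existential so that [choice] gives a total function;
   [set0] is a dummy value. *)
have step (nU : nat * set T) : exists V, good nU.2 ->
    good V /\ closure V `<=` nU.2 `\` A nU.1.
  case: nU => n U; have [[oU KU]|] := pselect (good U); last by exists set0.
  have : ~ (K `&` U `<=` A n) by move=> KUA; apply: noU; exists n, U.
  move=> /existsNP[x /not_implyP[[Kx Ux] nAx]].
  have [|V Vx VUA] := Treg x (U `\` A n).
    apply: open_nbhs_nbhs; split=> //; rewrite setDE.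
    by apply: openI => //; exact: closed_openC.
  exists V° => _ /=; split.
    by split; [exact: open_interior|exists x].
  by apply: subset_trans VUA; apply: closureS; exact: interior_subset.
have [next nextP] := choice step.
pose U := fix U n := if n is m.+1 then next (m, U m) else setT.
have Ugood n : good (U n).
  elim: n => [|n IH]; first by split; [exact: openT|rewrite setIT].
  by have [] := nextP (n, U n) IH.
have USD n : closure (U n.+1) `<=` U n `\` A n.
  by have [] := nextP (n, U n) (Ugood n).
have Udec n m : n <= m -> U m `<=` U n.
  elim: m => [|m IH]; first by rewrite leqn0 => /eqP ->.
  rewrite leq_eqVlt => /predU1P[->//|/IH mn x Um].
  by apply: mn; have [] := USD m x (subset_closure Um).
have [x xP] := choice (fun n => (Ugood n).2).
have xK : (x @ \oo) K by exists 0 => // n _ /=; have [] := xP n.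
have [y [Ky cly]] := cK _ (fmap_proper_filter x _) xK.
have [n _ Any] := KA y Ky.
suff : closure (U n.+1) y by move=> /USD[].
move=> V Vy; apply: cly Vy; exists n.+1 => // m /= nm.
by apply: (Udec _ _ nm); have [] := xP m.
Qed.

Lemma hausdorff_open_separation (Z : topologicalType) (a b : Z) :
  hausdorff_space Z -> a <> b ->
  exists A B : set Z, [/\ nbhs a A, nbhs b B & forall z, A z -> ~ B z].
Proof.
rewrite open_hausdorff => hZ /eqP /hZ[[A B] /= [aA bB] [oA oB AB0]].
exists A, B; split.
- by apply: open_nbhs_nbhs; split=> //; exact: set_mem.
- by apply: open_nbhs_nbhs; split=> //; exact: set_mem.
- move=> z Az Bz.
  by have : (A `&` B) z by []; rewrite (eqP AB0).
Qed.

(** If [p] is discontinuous at [x], the images of points near [x] that stay outside some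
    neighbourhood [V] of [p x] cluster at some [y] other than [p x]. A function [f] separating [y]
    from [p x] contradicts the continuity of [f \o p] at [x]. *)
Lemma continuous_separating (X Y Z : topologicalType) (p : X -> Y)
    (W : set (Y -> Z)) : compact [set: Y] -> hausdorff_space Z ->
    (forall f, W f -> continuous f /\ continuous (f \o p)) ->
    (forall y y', y <> y' -> exists2 f, W f & f y <> f y') ->
  continuous p.
Proof.
move=> cY hZ Wc Wsep x V Vpx; apply: contrapT => nVx.
have FP : ProperFilter (p @ within (~` (p @^-1` V)) (nbhs x)).
  apply: fmap_proper_filter; apply: Build_ProperFilter_ex => B xB.
  apply: contrapT => nB; apply: nVx.
  suff : nbhs x (p @^-1` V) by [].
  have {}xB : nbhs x [set z | ~ V (p z) -> B z] := xB.
  apply: filterS xB => z /= zB.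
  by apply: contrapT => nVz; apply: nB; exists z; exact: zB.
have [y [_ cly]] := cY _ FP filterT.
have ypx : y <> p x.
  move=> yE; have yV : nbhs y V by rewrite yE.
  have FnV : (p @ within (~` (p @^-1` V)) (nbhs x)) (~` V).
    exact: (@filterE _ (nbhs x)).
  by have [z []] := cly _ _ FnV yV.
have [f Wf fypx] := Wsep _ _ ypx; have [fc fpc] := Wc _ Wf.
have [A [B [Ay Bp AB]]] := hausdorff_open_separation hZ fypx.
have FB : (p @ within (~` (p @^-1` V)) (nbhs x)) (f @^-1` B).
  by apply: (@filterS _ (nbhs x) _ _ _ _ (fpc x _ Bp)) => z Bz _.
have [z [Bz Az]] := cly _ _ FB (fc _ _ Ay).
exact: AB Az Bz.
Qed.

(** * The enveloping (Ellis) semigroup of a distal flow *)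

Section enveloping_semigroup.
Import ArrowAsProduct.
Context (G : topologicalGroupType) (X : topologicalType) (phi : flow G X).
Implicit Types S : set G.

Definition enveloping (S : set G) : set (X -> X) := closure (act phi @` S).

Lemma act_enveloping S g : S g -> enveloping S (act phi g).
Proof. by move=> Sg; apply: subset_closure; exists g. Qed.

Lemma act_comp g h : act phi g \o act phi h = act phi (g * h)%g.
Proof. by apply/funext => x /=; rewrite actM. Qed.

Lemma comp_closed_enveloping S :
  (forall g h, S g -> S h -> S (g * h)%g) -> comp_closed (enveloping S).
Proof.
move=> SM; apply: comp_closed_closure.
  by move=> _ [g _ <-]; exact: act_continuousr.
by move=> _ _ [g Sg <-] [h Sh <-]; exists (g * h)%g; [exact: SM|rewrite act_comp].
Qed.

Lemma closed_enveloping S : closed (enveloping S).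
Proof. exact: closed_closure. Qed.

End enveloping_semigroup.

Section distal_flow.
Import ArrowAsProduct.
Context (G : topologicalGroupType) (X : uniformType) (phi : flow G X).
Context (T : set G).
Hypothesis X_compact : compact [set: X].
Hypothesis X_hausdorff : hausdorff_space X.
Hypothesis T_subsemigroup : subsemigroup_with_id T.
Hypothesis T_generates : generated_subgroup T = [set: G].
Hypothesis T_distal : distal_semiflow phi T.

(** Both [x] and [u x] are sent by [u] to [u x]. As [u] is a pointwise limit of elements of [T],
    some [t] brings the two points close to [u x] at once, so distality forces [u x = x]. *)
Lemma distal_idempotent u : enveloping phi T u -> u \o u = u -> u = id.
Proof.
move=> Eu uu; apply/funext => x; apply: contrapT => /T_distal[a ea aT].
have uux : u (u x) = u x by rewrite -[LHS]/((u \o u) x) uu.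
pose b := split_ent a.
pose V z : set (X -> X) := (fun p => p z) @^-1` xsection (b `&` b^-1)%relation (u z).
have Vu z : nbhs u (V z).
  apply: (@continuous_eval X X z u (xsection (b `&` b^-1)%relation (u z))).
  apply: nbhs_entourage; apply: filterI; [|apply: entourage_inv];
  exact: entourage_split_ent.
have [_ [[t Tt <-]]] := Eu _ (filterI (Vu (u x)) (Vu x)).
rewrite /V /= /xsection /= !inE uux => -[[_ b1] [b2 _]].
by apply: (aT t Tt); apply: (entourage_split (u x)).
Qed.

Lemma enveloping_inverse p : enveloping phi T p ->
  exists q, [/\ enveloping phi T q, q \o p = id & p \o q = id].
Proof.
apply: closed_subsemigroup_inverse => //; first exact: closed_enveloping.
  apply: comp_closed_enveloping => g h Tg Th.
  by case: T_subsemigroup => _ /(_ g h); rewrite !inE; exact.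
exact: distal_idempotent.
Qed.

(** The elements of [G] acting through the enveloping semigroup of [T] form a subgroup containing
    [T]: that semigroup is a group, and the inverse in it of the action of [k] can only be the
    action of [k^-1]. *)
Lemma enveloping_generated g : enveloping phi T (act phi g).
Proof.
have [T1 TM] := T_subsemigroup.
have EM : comp_closed (enveloping phi T).
  by apply: comp_closed_enveloping => h k Th Tk; have := TM h k; rewrite !inE; exact.
have : generated_subgroup T g by rewrite T_generates.
apply: (@smallest_sub _ _ T [set h | enveloping phi T (act phi h)]) => /=.
  split; first by rewrite inE; apply: act_enveloping; exact: set_mem.
  move=> h k; rewrite !inE => Eh /enveloping_inverse[q [Eq qk kq]].
  rewrite /= -act_comp; apply: EM => //.
  suff -> : act phi k^-1%g = q by [].
  rewrite -[LHS]/(act phi k^-1%g \o id) -kq compA act_comp mulVg.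
  by apply/funext => x /=; rewrite act1.
by move=> t Tt; exact: act_enveloping.
Qed.

Lemma enveloping_setT : enveloping phi setT `<=` enveloping phi T.
Proof.
move=> p Ep; apply: closed_enveloping; apply: closureS Ep => _ [g _ <-].
exact: enveloping_generated.
Qed.

End distal_flow.

(** * Weakly almost periodic functions and continuity of the enveloping semigroup *)

Section wap.
Import ArrowAsProduct.

(** As [t] tends to [p], the translates of [f] cluster at some [g] that is continuous, since
    compactness holds inside C(X). Their values converge pointwise to [f \o p], so [f \o p = g]. *)
Lemma wap_enveloping_continuous (R : realType) (G : topologicalGroupType)
    (X : topologicalType) (phi : flow G X) (T : set G)
    (f : continuousType X R) (p : X -> X) :
  weakly_almost_periodic phi T f -> enveloping phi T p -> continuous (f \o p).
Proof.
move=> [C TC [cC _]] Ep.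
pose orb (V : set (X -> X)) : set (continuousType X R) :=
  [set (f \o act phi t : continuousType X R) | t in [set t | T t /\ V (act phi t)]].
have FP : ProperFilter (filter_from (nbhs p) orb).
  apply: filter_from_proper.
    apply: filter_from_filter; first by exists setT; exact: filterT.
    move=> V W pV pW; exists (V `&` W); first exact: filterI.
    by move=> _ [t [Tt [Vt Wt]] <-]; split; exists t.
  move=> V /Ep[_ [[t Tt <-] Vt]].
  by exists (f \o act phi t : continuousType X R); exists t.
have FC : filter_from (nbhs p) orb C.
  exists setT; first exact: filterT.
  by move=> _ [t [Tt _] <-]; apply: TC; exists t.
have [g [_ clg]] := cC _ FP FC.
suff -> : f \o p = g by exact: cts_fun.
apply/funext => x /=; apply: contrapT => fpg.
have [A [B [Ap Bg AB]]] := hausdorff_open_separation (@Rhausdorff R) fpg.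
have Vp : nbhs p [set q : X -> X | A (f (q x))].
  exact: (@continuous_eval X X x p _ (@cts_fun _ _ f _ _ Ap)).
have Wg : nbhs g [set h : continuousType X R | B (h x)].
  have := @initial_continuous _ _ (id : continuousType X R -> (X -> R)) g.
  move=> /(_ [set h : X -> R | B (h x)]); apply.
  exact: (@continuous_eval X R x g _ Bg).
have FV : filter_from (nbhs p) orb (orb [set q : X -> X | A (f (q x))]).
  by exists [set q : X -> X | A (f (q x))].
have [_ [[t [_ At] <-] Bt]] := clg _ _ FV Wg.
exact: AB At Bt.
Qed.

End wap.

Section enveloping_continuous.
Import ArrowAsProduct.
Context (R : realType) (G : topologicalGroupType) (X : uniformType).
Context (phi : flow G X) (T : set G).
Hypothesis X_compact : compact [set: X].
Hypothesis X_hausdorff : hausdorff_space X.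
Hypothesis phi_minimal : minimal_flow phi.
Hypothesis T_subsemigroup : subsemigroup_with_id T.
Hypothesis T_generates : generated_subgroup T = [set: G].
Hypothesis T_distal : distal_semiflow phi T.

(* Weakly almost periodic functions belong to this set, which is moreover stable
   under composition with the enveloping semigroup. *)
Definition enveloping_stable : set (X -> R) :=
  [set f : X -> R | forall p, enveloping phi T p -> continuous (f \o p)].

(** Evaluation at [x] maps the compact enveloping semigroup onto a closed set, which contains the
    dense [G]-orbit of [x]. *)
Lemma enveloping_orbit (x y : X) : exists2 p, enveloping phi T p & p x = y.
Proof.
suff : [set p x | p in enveloping phi T] y by move=> [p Ep <-]; exists p.
have cl : closed [set p x | p in enveloping phi T].
  apply: compact_closed => //; apply: continuous_compact.
    by apply: continuous_subspaceT => p; exact: continuous_eval.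
  by apply: closed_selfmaps_compact => //; exact: closed_enveloping.
apply: cl => V; rewrite nbhsE => -[U [oU Uy] UV].
have [z [Uz [g _ gxz]]] := @phi_minimal x U (ex_intro _ y Uy) oU.
rewrite -gxz in Uz.
exists (act phi g x); split; last exact: UV.
by exists (act phi g) => //; exact: enveloping_generated.
Qed.

(** Some [p] moves [y] to [x0]; being invertible it keeps [p x] away from [x0], and a function
    separating these two is pulled back by [p]. *)
Lemma enveloping_stable_separates x0 :
    separates_point [set f : continuousType X R |
      weakly_almost_periodic phi T f] x0 ->
  forall x y : X, x <> y -> exists2 f, enveloping_stable f & f x <> f y.
Proof.
move=> sep x y xy.
have [p Ep pyx] := enveloping_orbit y x0.
have [q [_ qp _]] := enveloping_inverse X_compact X_hausdorff T_subsemigroup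
  T_distal Ep.
have [|f fwap fpx] := sep (p x).
  rewrite -pyx => pxy; apply: xy.
  by rewrite -[x]/(id x) -[y]/(id y) -qp /= pxy.
exists (f \o p); last by rewrite /= pyx.
move=> r Er; rewrite -compA; apply: (wap_enveloping_continuous fwap).
apply: comp_closed_enveloping Ep Er => g h Tg Th.
by case: T_subsemigroup => _ /(_ g h); rewrite !inE; exact.
Qed.

Lemma enveloping_stable_continuous f : enveloping_stable f -> continuous f.
Proof.
move=> fs; suff : continuous (f \o act phi 1%g).
  by rewrite (_ : f \o act phi 1%g = f)//; apply/funext => x /=; rewrite act1.
by apply: fs; exact: enveloping_generated.
Qed.

Lemma enveloping_continuous x0 p :
    separates_point [set f : continuousType X R |
      weakly_almost_periodic phi T f] x0 ->
  enveloping phi T p -> continuous p.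
Proof.
move=> sep Ep; apply: (continuous_separating (W := enveloping_stable)) X_compact
  (@Rhausdorff R) _ (enveloping_stable_separates sep) => f fs.
by split; [exact: enveloping_stable_continuous|exact: fs].
Qed.

End enveloping_continuous.

(** * Oscillations along a flow and their finite control *)

Section oscillation.
Import ArrowAsProduct.
Local Open Scope ring_scope.
Context (R : realType) (X : topologicalType) (f : X -> R).
Hypothesis f_continuous : continuous f.

Definition oscillation (p : X -> X) (z : X * X) : R := `|f (p z.1) - f (p z.2)|.

Lemma oscillation_continuous p : continuous p -> continuous (oscillation p).
Proof.
move=> pc z; apply: cvg_norm; apply: cvgB.
  apply: (continuous_comp (f := fst) (g := f \o p)); first exact: cvg_fst.
  by apply: continuous_comp; [exact: pc|exact: f_continuous].
apply: (continuous_comp (f := snd) (g := f \o p)); first exact: cvg_snd.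
by apply: continuous_comp; [exact: pc|exact: f_continuous].
Qed.

Lemma oscillation_continuousl z : continuous (oscillation ^~ z).
Proof.
move=> p; have ev y : continuous_at p (fun q : X -> X => f (q y)).
  by move=> V /f_continuous; exact: continuous_eval.
have FF : Filter (nbhs p) := nbhs_filter p.
exact: (@cvg_norm _ _ _ _ FF _ _ (@cvgB _ _ _ _ FF _ _ _ _ (ev z.1) (ev z.2))).
Qed.

Lemma oscillation_closure (S : set (X -> X)) z e :
  (forall p, S p -> oscillation p z <= e) ->
  forall p, closure S p -> oscillation p z <= e.
Proof.
move=> Se.
exact: (closure_preimage_closed (@oscillation_continuousl z) (@closed_le R e) Se).
Qed.

End oscillation.

Section equicontinuity.
Import ArrowAsProduct.
Local Open Scope ring_scope.
Context (R : realType) (G : topologicalGroupType) (X : uniformType).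
Context (phi : flow G X).
Hypothesis X_compact : compact [set: X].
Hypothesis X_hausdorff : hausdorff_space X.
Hypothesis idempotent_id :
  forall u, enveloping phi setT u -> u \o u = u -> u = id.
Hypothesis enveloping_cont : forall p, enveloping phi setT p -> continuous p.
Context (f : X -> R).
Hypothesis f_continuous : continuous f.

Let osc g := oscillation f (act phi g).

Lemma oscillation_finite_control (e : R) : 0 < e ->
  exists (F : seq G) (n : nat), forall z,
    (forall h, h \in F -> osc h z <= n.+1%:R^-1) -> forall g, osc g z <= e.
Proof.
move=> e0; apply: contrapT => noF.
have wit (Fn : seq G * nat) : exists w : G * (X * X),
    (forall h, h \in Fn.1 -> osc h w.2 <= Fn.2.+1%:R^-1) /\ e < osc w.1 w.2.
  apply: contrapT => now; apply: noF; exists Fn.1, Fn.2 => z zF g.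
  by rewrite leNgt; apply/negP => eg; apply: now; exists (g, z).
have [w wP] := choice wit.
(* F n increases to a countable subgroup H whose elements [(w (F n, n)).1]
   defeat every candidate [F n]. *)
pose next n F := (w (F, n)).1 :: F ++
  [seq (a * b)%g | a <- F, b <- F] ++ [seq (a^-1)%g | a <- F].
pose F := fix F n : seq G := if n is m.+1 then next m (F m) else [:: 1%g].
have Fmono n m : (n <= m)%N -> {subset F n <= F m}.
  elim: m => [|m IH]; first by rewrite leqn0 => /eqP ->.
  rewrite leq_eqVlt => /predU1P[->//|/IH mn x /mn Fx].
  by rewrite inE mem_cat Fx orbT.
have FM n a b : a \in F n -> b \in F n -> (a * b)%g \in F n.+1.
  move=> Fa Fb; rewrite inE !mem_cat; apply/orP; right; apply/orP; right.
  by apply/orP; left; apply/allpairsP; exists (a, b).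
have FV n a : a \in F n -> (a^-1)%g \in F n.+1.
  move=> Fa; rewrite inE !mem_cat; apply/orP; right; apply/orP; right.
  by apply/orP; right; apply/mapP; exists a.
pose H : set G := [set g | exists n, g \in F n].
have HM g h : H g -> H h -> H (g * h)%g.
  move=> [n Fg] [m Fh]; exists (maxn n m).+1; apply: FM.
    exact: Fmono (leq_maxl _ _) _ Fg.
  exact: Fmono (leq_maxr _ _) _ Fh.
pose K := enveloping phi H.
have KE : K `<=` enveloping phi setT by apply: closureS; exact: image_subset.
have KM : comp_closed K by exact: comp_closed_enveloping.
have cK : compact K.
  by apply: closed_selfmaps_compact => //; exact: closed_enveloping.
have Kinv p : K p -> exists q, [/\ K q, q \o p = id & p \o q = id].
  apply: closed_subsemigroup_inverse => //; first exact: closed_enveloping.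
  by move=> u /KE; exact: idempotent_id.
(* The single index [n] governs both the finite set and the threshold, which makes the cover
   countable. *)
pose A n : set (X -> X) := [set p | forall z,
  (forall h, h \in F n -> osc h z <= n.+1%:R^-1) -> oscillation f p z <= e].
have cA n : closed (A n).
  by move=> p clp z zF; apply: oscillation_closure clp => // q; exact.
(* If [p] escapes every [A n], the bad pairs cluster at some [z] where all oscillations along [H],
   hence that of their limit [p], vanish; yet continuity of [p] keeps its oscillation at [z] from
   being below [e]. *)
have KA : K `<=` \bigcup_n A n.
  move=> p Kp; apply: contrapT => nA.
  have bad n : exists z, (forall h, h \in F n -> osc h z <= n.+1%:R^-1) /\
      e < oscillation f p z.
    apply: contrapT => nz; apply: nA; exists n => // z zF.
    by rewrite leNgt; apply/negP => ez; apply: nz; exists z.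
  have [y yP] := choice bad.
  have XX : compact [set: X * X] by rewrite -setXTT; exact: compact_setX.
  have yT : (y @ \oo) [set: X * X] by exact: filterT.
  have [z [_ clz]] := XX _ (fmap_proper_filter y _) yT.
  have zH h : H h -> osc h z <= 0.
    move=> [m Fh]; rewrite leNgt; apply/negP => h0.
    pose d := osc h z / 2.
    have d0 : 0 < d by rewrite divr_gt0.
    have nz : nbhs z [set z' | d < osc h z'].
      have hc := @act_continuousr _ _ phi h.
      apply: (@oscillation_continuous _ _ _ f_continuous _ hc z [set r | d < r]).
      by apply: lt_nbhsr; rewrite /d -/(osc h z); lra.
    have yn : \forall n \near \oo, osc h (y n) < d.
      near=> n; have [yF _] := yP n.
      apply: le_lt_trans (yF h _) _.
        by apply: (Fmono m) => //; near: n; exact: nbhs_infty_ge.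
      by near: n; exact: (near_infty_natSinv_lt (PosNum d0)).
    have [z' [/= ez ze]] := clz [set z' | osc h z' < d] _ yn nz.
    by have := lt_trans ez ze; rewrite ltxx.
  have zp : oscillation f p z <= 0.
    by apply: oscillation_closure Kp => // _ [h Hh <-]; exact: zH.
  have nz : nbhs z [set z' | oscillation f p z' < e].
    have pc := enveloping_cont (KE _ Kp).
    apply: (@oscillation_continuous _ _ _ f_continuous _ pc z [set r | r < e]).
    by apply: (lt_nbhsl); apply: le_lt_trans e0.
  have yn : (y @ \oo) [set z' | e < oscillation f p z'].
    by exists 0%N => // n _; have [] := yP n.
  have [z' [/= ez ze]] := clz _ _ yn nz.
  by have := lt_trans ez ze; rewrite ltxx.
have K1 : K (act phi 1%g) by apply: act_enveloping; exists 0%N; rewrite inE.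
have [n [U [oU [u0 [Ku0 Uu0]] KUA]]] :=
  compact_baire uniform_regular cK (ex_intro _ _ K1) cA KA.
have [m _ mP] : \forall m \near \oo,
    K `<=` (fun q => exists2 h, h \in F m & U (q \o act phi h)).
  (* Since [q] composed with [q' \o u0] is [u0], replacing [q' \o u0] by a nearby [h] of [H] keeps
     the product in [U], by continuity of [q]. The same [h] works near [q], and compactness puts all
     the [h] needed in one [F m]. *)
  move/compact_near_coveringP : cK; apply => q Kq.
  have [q' [Kq' _ qq']] := Kinv _ Kq.
  have Kr : K (q' \o u0) by exact: KM.
  have Ur : nbhs (q' \o u0) [set r : X -> X | U (q \o r)].
    apply: (continuous_postcomp (enveloping_cont (KE _ Kq))).
    by rewrite compA qq'; apply: open_nbhs_nbhs.
  have [_ [[h [i Fh] <-] Uqh]] := Kr _ Ur.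
  exists ([set r : X -> X | U (r \o act phi h)], [set m | i <= m]%N) => /=.
    split; last by exists i.
    by apply: (@continuous_precomp _ (act phi h)); apply: open_nbhs_nbhs.
  by move=> [r j] /= [Ur' ij]; exists h => //; exact: Fmono ij _ Fh.
have {}mP := mP m (leqnn m).
(* Above [maxn n m], one stage is for inverting [h] in [F m] and one for multiplying by [a] in
   [F n]; thus [a * h^-1] lies in [F N]. *)
pose N := (maxn n m).+2.
have [wF] := wP (F N, N); set g := (w _).1; set z := (w _).2 => /= eg.
have Kg : K (act phi g).
  by apply: act_enveloping; exists N.+1; rewrite inE eqxx.
have [h Fh Ugh] := mP _ Kg.
have Kgh : K (act phi g \o act phi h).
  by apply: KM => //; apply: act_enveloping; exists m.
have hh x : act phi h (act phi (h^-1)%g x) = x by rewrite -actM mulgV act1.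
(* Shifting [z] by [h^-1] turns the oscillation of [g h] into that of [g] at [z], and that of [a]
   into that of [a * h^-1], which is small by the choice of [z]. *)
have := KUA _ (conj Kgh Ugh) (act phi (h^-1)%g z.1, act phi (h^-1)%g z.2).
rewrite /oscillation /= !hh -/(osc g z) leNgt eg => /(_ _)/negP; apply => // a Fa.
rewrite /osc /oscillation /= -!actM -/(osc (a * h^-1)%g z).
apply: (@le_trans _ _ N.+1%:R^-1).
  apply: wF; apply: FM; last by apply: FV; exact: Fmono (leq_maxr _ _) _ Fh.
  by apply: Fmono Fa; rewrite leqW// leq_maxl.
rewrite lef_pV2 ?posrE ?ltr0n// ler_nat /N.
by rewrite ltnS; apply: (leq_trans (leq_maxl n m)); rewrite !leqW.
Unshelve. all: by end_near. Qed.
End equicontinuity.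

(** * From finite control to equicontinuity *)

Lemma entourage_nbhs_diagonal (X : uniformType) (a : set (X * X)) (x : X) :
  entourage a -> nbhs (x, x) a.
Proof.
move=> ea; pose b := split_ent a.
have xb : nbhs x (xsection (b `&` b^-1)%relation x).
  apply: nbhs_entourage; apply: filterI; last apply: entourage_inv;
  exact: entourage_split_ent.
exists (xsection (b `&` b^-1)%relation x, xsection (b `&` b^-1)%relation x) => //.
move=> [y z] [/= /xsectionP[_ yx] /xsectionP[xz _]].
exact: (entourage_split x).
Qed.

(** Near each [x] all sufficiently small entourages work, by a halving argument; compactness makes
    one entourage serve everywhere. *)
Lemma compact_nbhs_diagonal_entourage (X : uniformType) (E : set (X * X)) :
  compact [set: X] -> (forall x : X, nbhs (x, x) E) -> entourage E.
Proof.
move=> /compact_near_coveringP cX nE.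
(* In the nonempty case the point [(x0, x0)] of the diagonal makes the filter of entourages
   proper. *)
have [[x0 _]|X0] := pselect (exists x : X, True); last first.
  by apply: filterE => -[x y]; case: X0; exists x.
have entX : ProperFilter (@entourage X).
  apply: Build_ProperFilter_ex => a ea; exists (x0, x0).
  exact: entourage_refl.
have : \forall d \near powerset_filter_from (@entourage X),
    [set: X] `<=` (fun x => forall y, d (x, y) -> E (x, y)).
  apply: cX => x _; have : filter_prod (nbhs x) (nbhs x) E by exact: nE.
  move=> [[U V] [/= xU xV] UVE].
  have /nbhsP[a ea aUV] : nbhs x (U `&` V) by exact: filterI.
  exists (xsection (split_ent a) x, [set d | d `<=` split_ent a]) => /=.
    split; first by apply: nbhs_entourage; exact: entourage_split_ent.
    by apply: small_set_sub; exact: entourage_split_ent.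
  move=> [x' d] /= [/xsectionP xx' da] y /da x'y.
  have [Ux' _] := aUV x' (mem_set (split_ent_subset ea xx')).
  have [_ Vy] := aUV y (mem_set (entourage_split x' ea xx' x'y)).
  exact: UVE.
move=> /(filterI (near_small_set _)) => dE.
have [d [ed dE']] := filter_ex dE.
by apply: filterS ed => -[x y]; exact: dE'.
Qed.

Section equicontinuity_criterion.
Import ArrowAsProduct.
Local Open Scope ring_scope.
Context (R : realType) (G : topologicalGroupType) (X : uniformType).
Context (phi : flow G X).
Hypothesis X_compact : compact [set: X].
Hypothesis X_hausdorff : hausdorff_space X.
Hypothesis idempotent_id :
  forall u, enveloping phi setT u -> u \o u = u -> u = id.
Hypothesis enveloping_cont : forall p, enveloping phi setT p -> continuous p.

(** The controlling condition is a finite intersection of sets, each containing a neighbourhood of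
    the diagonal because oscillations vanish there. *)
Lemma oscillation_entourage (f : X -> R) (e : R) : continuous f -> 0 < e ->
  exists2 d, entourage d &
    forall z, d z -> forall g, oscillation f (act phi g) z <= e.
Proof.
move=> fc e0.
have [F [n Fn]] := oscillation_finite_control X_compact X_hausdorff
  idempotent_id enveloping_cont fc e0.
exists [set z | forall h, h \in F -> oscillation f (act phi h) z <= n.+1%:R^-1];
  last exact: Fn.
elim: F {Fn} => [|h F IH]; first by apply: filterE.
have hF : entourage [set z | oscillation f (act phi h) z < n.+1%:R^-1].
  apply: compact_nbhs_diagonal_entourage => // x.
  have hc := @act_continuousr _ _ phi h.
  apply: (@oscillation_continuous _ _ _ fc _ hc (x, x) [set r | r < n.+1%:R^-1]).
  by apply: lt_nbhsl; rewrite /oscillation subrr normr0 invr_gt0.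
apply: filterS (filterI hF IH) => z [/= hz zF] k.
by rewrite inE => /predU1P[->|/zF//]; exact: ltW.
Qed.

(** Otherwise arbitrarily close pairs have images outside [e], and these images cluster at some
    [(x, y)]. Off the diagonal a separating [f] contradicts [oscillation_entourage]; on it, [e] is a
    neighbourhood of [(x, y)]. *)
Lemma equicontinuous_of_separating :
    (forall x y : X, x <> y -> exists2 f : X -> R, continuous f & f x <> f y) ->
  equicontinuous_flow phi.
Proof.
move=> sep e ee; apply: contrapT => nd.
pose bad (d : set (X * X)) : set (X * X) := [set w | ~ e w /\
  exists z g, d z /\ w = (act phi g z.1, act phi g z.2)].
have FP : ProperFilter (filter_from (@entourage X) bad).
  apply: filter_from_proper.
    apply: filter_from_filter; first by exists setT; exact: entourageT.
    move=> a b ea eb; exists (a `&` b); first exact: filterI.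
    by move=> w [ew [z [g [[az bz] wE]]]]; split; split=> //; exists z, g.
  move=> d ed; apply: contrapT => n0; apply: nd; exists d => // x y dxy g.
  apply: contrapT => neg; apply: n0; exists (act phi g x, act phi g y).
  by split=> //; exists (x, y), g.
have XX : compact [set: X * X] by rewrite -setXTT; exact: compact_setX.
have [[x y] [_ clxy]] := XX _ FP filterT.
have [xy|xy] := pselect (x = y).
  have ne : filter_from (@entourage X) bad (~` e).
    by exists setT; [exact: entourageT|move=> w []].
  have exy : nbhs (x, y) e by rewrite -xy; exact: entourage_nbhs_diagonal.
  by have [w []] := clxy _ _ ne exy.
have [f fc fxy] := sep _ _ xy.
(* The oscillation of [f] under [id] at an image pair is that under [g] at the original pair;
   [r / 2] separates the bound near the diagonal from the value at [(x, y)]. *)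
pose r := oscillation f id (x, y).
have r0 : 0 < r / 2 by rewrite divr_gt0// normr_gt0 subr_eq0; exact/eqP.
have [d ed dr] := oscillation_entourage fc r0.
have Fr : filter_from (@entourage X) bad [set w | oscillation f id w <= r / 2].
  by exists d => // _ [_ [z [g [dz ->]]]]; exact: dr.
have nr : nbhs (x, y) [set w | r / 2 < oscillation f id w].
  have idc : continuous (@id X) by move=> u; exact: cvg_id.
  apply: (@oscillation_continuous _ _ _ fc _ idc (x, y) [set s | r / 2 < s]).
  by apply: lt_nbhsr; rewrite -/r; lra.
have [w [/= wr rw]] := clxy _ _ Fr nr.
by have := le_lt_trans wr rw; rewrite ltxx.
Qed.

End equicontinuity_criterion.

Theorem theorem8p10 (R : realType) (G : topologicalGroupType)
    (X : uniformType) (phi : flow G X) (T : set G)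
    (X_nonempty : [set: X] !=set0)
    (X_compact : compact [set: X])
    (X_hausdorff : hausdorff_space X)
    (phi_minimal : minimal_flow phi)
    (T_subsemigroup : subsemigroup_with_id T)
    (T_generates : generated_subgroup T = [set: G])
    (T_distal : distal_semiflow phi T)
    (wap_separate : exists x0 : X,
       separates_point [set f : continuousType X R |
                         weakly_almost_periodic phi T f] x0) :
  equicontinuous_flow phi.
Proof.
have [x0 sep] := wap_separate.
(* The criterion concerns the closure of the whole group, while distality and weak almost
   periodicity give information on that of [T]. *)
have ET p : enveloping phi setT p -> enveloping phi T p.
  exact: enveloping_setT.
apply: (equicontinuous_of_separating (R := R)) => //.
- by move=> u /ET; exact: (distal_idempotent T_distal).
- by move=> p /ET; exact: enveloping_continuous sep.
- move=> x y xy.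
  have [f fs fxy] := enveloping_stable_separates X_compact X_hausdorff
    phi_minimal T_subsemigroup T_generates T_distal sep xy.
  exists f => //; apply: enveloping_stable_continuous fs => //.
Qed.
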